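(* Let $G$ be a simple graph of order $n$. Then $G$ is connected if and only if $\deg_x\bigl(da(G;x,y)\bigr)=n$.
   Context: All graphs are finite, simple and have at least one vertex. For a graph $G$, $S\subseteq V(G)$ and $u\in V(G)$, let $\bar S=V(G)\setminus S$, let $\delta_S(u)=|\{v\in S:\{u,v\}\in E(G)\}|$, and let $G[S]$ be the subgraph induced by $S$. The defensive alliance polynomial of $G$ is $$da(G;x,y)=\sum_{S} x^{|S|}\,y^{f_y(S)},\qquad f_y(S)=\min_{u\in S}\bigl(\delta_S(u)-\delta_{\bar S}(u)+|V(G)|\bigr),$$ where the sum runs over all non-empty $S\subseteq V(G)$ such that $G[S]$ is connected (single-vertex graphs are connected). $\deg_x$ denotes the degree in the variable $x$. *)

(* Defs.v *)
From HB Require Import structures.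
From mathcomp Require Import all_boot all_order all_algebra.

Set Implicit Arguments.
Unset Strict Implicit.
Unset Printing Implicit Defensive.

Import GRing.Theory.
Local Open Scope ring_scope.

(* The vertex type may be empty here; nonemptiness is assumed in theorems. *)
Record sgraph := SGraph {
  vertex :> finType;
  adj : rel vertex;
  adj_sym : symmetric adj;
  adj_irr : irreflexive adj
}.

Definition graph_order (G : sgraph) : nat := #|G|.

Definition graph_connected (G : sgraph) : bool :=
  (0 < graph_order G)%N && [forall u : G, forall v : G, connect (@adj G) u v].

Section Induced.
Variables (G : sgraph) (S : {set G}).

Definition induced_adj : rel {u : G | u \in S} :=
  fun u v => adj (val u) (val v).

Fact induced_sym : symmetric induced_adj.
Proof. by move=> u v; apply: adj_sym. Qed.

Fact induced_irr : irreflexive induced_adj.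
Proof. by move=> u; apply: adj_irr. Qed.

Definition induced : sgraph := SGraph induced_sym induced_irr.
End Induced.

Section AlliancePolynomial.
Variable G : sgraph.

Definition delta (S : {set G}) (u : G) : nat := #|[set v in S | adj u v]|.

(* [delta S u - delta (~: S) u + graph_order G], with the terms reordered so
   that the natural-number subtraction is not truncated
   ([delta (~: S) u <= graph_order G]). *)
Definition alliance_term (S : {set G}) (u : G) : nat :=
  (delta S u + graph_order G - delta (~: S) u)%N.

(* [2 * graph_order G] bounds every term from above, so for [S != set0]
   it does not affect the minimum; see [fyP]. *)
Definition fy (S : {set G}) : nat :=
  \big[minn/(2 * graph_order G)%N]_(u in S) alliance_term S u.

(* As in [polyXY], the outer variable is ['X] (for x) and
   ['Y := 'X%:P] is the inner one (for y). *)
Definition da : {poly {poly int}} :=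
  \sum_(S : {set G} | (S != set0) && graph_connected (induced S))
     'X^#|S| * 'Y ^+ fy S.

Lemma alliance_termE (S : {set G}) (u : G) :
  (alliance_term S u)%:Z =
  (delta S u)%:Z - (delta (~: S) u)%:Z + (graph_order G)%:Z.
Proof.
have le_n : (delta (~: S) u <= delta S u + graph_order G)%N.
  by apply: leq_trans (leq_addl _ _); apply: max_card.
by rewrite /alliance_term -subzn // PoszD addrAC.
Qed.

Lemma fyP (S : {set G}) : S != set0 ->
  (exists2 u, u \in S & fy S = alliance_term S u) /\
  (forall u, u \in S -> (fy S <= alliance_term S u)%N).
Proof.
move=> S0; have le_fy u : u \in S -> (fy S <= alliance_term S u)%N.
  move=> uS; rewrite /fy; have := mem_index_enum u.
  elim: (index_enum _) => // v r IHr; rewrite inE big_cons.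
  case/predU1P=> [<-|/IHr le_r]; first by rewrite uS geq_minl.
  by case: ifP => // _; apply: leq_trans (geq_minr _ _) le_r.
split=> //; have [u0 u0S] := set0Pn _ S0.
case: (arg_minnP (alliance_term S) u0S) => u uS min_u; exists u => //.
apply/eqP; rewrite eqn_leq le_fy //=.
rewrite /fy; elim/big_ind: _ => [|a b ha hb|v vS]; last exact: min_u.
- apply: leq_trans (leq_subr _ _) _.
  by rewrite mul2n -addnn leq_add2r; apply: max_card.
- by rewrite leq_min ha hb.
Qed.

End AlliancePolynomial.

(* [size] is the degree plus one; the zero polynomial gets degree 0. *)
Definition degX (p : {poly {poly int}}) : nat := (size p).-1.

(* Main.v *)
Require Import Defs.
From mathcomp Require Import all_boot all_order all_algebra.

(** The coefficient of [x^n] only sees [S = V(G)], the one vertex set of size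
    [n], so it is the single monomial [y^(f_y(V(G)))] if [G] is connected and
    [0] otherwise; no higher power of [x] occurs. *)

Import GRing.Theory.

Lemma homo_connect (T U : finType) (r : rel T) (s : rel U) (f : T -> U) :
  {homo f : x y / r x y >-> s x y} ->
  {homo f : x y / connect r x y >-> connect s x y}.
Proof.
move=> f_homo x _ /connectP[p r_p ->]; apply/connectP.
by exists (map f p); [apply: homo_path r_p | rewrite last_map].
Qed.

(** The vertices of [induced [set: G]] form a sigma type, so the two graphs are only isomorphic;
    [val] and its inverse both preserve adjacency, hence paths. *)
Lemma graph_connected_induced_setT (G : sgraph) :
  graph_connected (induced [set: G]) = graph_connected G.
Proof.
rewrite /graph_connected /graph_order.
have -> : #|induced [set: G]| = #|G|.
  by rewrite card_sig; apply: eq_card => x; rewrite !inE.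
congr (_ && _); apply/forallP/forallP => conn u; apply/forallP => v.
- have uT := in_setT u; have vT := in_setT v.
  have /forallP/(_ (exist _ v vT)) := conn (exist _ u uT).
  exact: (@homo_connect (induced [set: G]) G _ _ val).
- pose f (x : G) : induced [set: G] := exist _ x (in_setT x).
  have fK x : f (val x) = x by apply: val_inj.
  rewrite -(fK u) -(fK v).
  have /forallP/(_ (val v)) := conn (val u).
  exact: (@homo_connect G (induced [set: G]) _ _ f).
Qed.

(** Powers of ['Y] are constants in x, so only sets of size [i] contribute. On the right-hand side
    ['X] is the inner variable y. *)
Lemma coef_da (G : sgraph) (i : nat) :
  ((da G)`_i = \sum_(S : {set G} | ((S != set0) &&
     graph_connected (induced S)) && (#|S| == i)) 'X^(fy S))%R.
Proof.
rewrite /da coef_sum [RHS]big_mkcondr; apply: eq_bigr => S _ /=.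
by rewrite -polyC_exp mulrC coefCM coefXn eq_sym mulr_natr mulrb.
Qed.

Lemma size_da_leq (G : sgraph) : size (da G) <= (graph_order G).+1.
Proof.
apply/leq_sizeP => i lt_n_i; rewrite coef_da big_pred0 // => S.
by rewrite [#|S| == i]ltn_eqF ?andbF // (leq_ltn_trans (max_card _)).
Qed.

Lemma coef_da_order (G : sgraph) : 0 < graph_order G ->
  ((da G)`_(graph_order G) =
     if graph_connected G then 'X^(fy [set: G]) else 0)%R.
Proof.
move=> G_nonempty; rewrite coef_da -graph_connected_induced_setT.
rewrite (eq_bigl (fun S => (S == [set: G]) &&
  graph_connected (induced [set: G]))).
  by rewrite big_mkcondr big_pred1_eq.
move=> S; have -> : (#|S| == graph_order G) = (S == [set: G]).
  by rewrite eqEcard subsetT cardsT eqn_leq max_card.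
case: (eqVneq S [set: G]) => [->|_]; last by rewrite andbF.
(* [[set: G]] passes the filter [S != set0] because [G] has a vertex. *)
by rewrite -cards_eq0 cardsT -lt0n G_nonempty andbT.
Qed.

Theorem proposition11 (G : sgraph) (n : nat)
  (G_nonempty : 0 < graph_order G) (G_order : graph_order G = n) :
  graph_connected G <-> degX (da G) = n.
Proof.
have size_le := size_da_leq G; have coef_n := coef_da_order G G_nonempty.
rewrite -G_order /degX; split=> [G_conn | deg_n].
- suff lt_n : graph_order G < size (da G).
    by have /eqP -> : size (da G) == (graph_order G).+1 by rewrite eqn_leq size_le.
  (* A smaller size would make the coefficient of index [graph_order G] vanish, but it is a monic
     monomial in y. *)
  rewrite ltnNge; apply/negP => /leq_sizeP/(_ _ (leqnn _)).
  by rewrite coef_n G_conn; apply/eqP; rewrite monic_neq0 ?monicXn.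
(* [degX] is also 0 on the zero polynomial; a positive order excludes that case. The nonzero leading
   coefficient then has index [graph_order G], where a disconnected [G] would give 0. *)
- have: lead_coef (da G) != 0%R.
    by rewrite lead_coef_eq0 -size_poly_gt0 (leq_trans G_nonempty) // -deg_n leq_pred.
  by rewrite lead_coefE deg_n coef_n; case: ifP => // _; rewrite eqxx.
Qed.
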